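(* Let $k$ be a field. The forgetful functor $F$ from the category of Poisson Hopf algebras over $k$ to the category of coalgebras over $k$ has a left adjoint; i.e. there exists a free Poisson Hopf algebra on every coalgebra.
   Context: All vector spaces, algebras, coalgebras (coassociative, counital) and tensor products are over a fixed field $k$, and all associative algebras are unital. A Poisson algebra is a vector space $P$ that is both an associative commutative unital algebra and a Lie algebra with bracket $[-,-]$ such that $[p, qr] = [p,q]\,r + q\,[p,r]$ for all $p,q,r \in P$. A morphism of Poisson algebras is a linear map that is both a (unital) algebra map and a Lie algebra map. If $P_1, P_2$ are Poisson algebras, then $P_1 \otimes P_2$ is a Poisson algebra with $(p\otimes q)(r \otimes s) = pr \otimes qs$ and $[p\otimes q, r\otimes s] = pr \otimes [q,s] + [p,r]\otimes qs$. The field $k$ is a Poisson algebra with zero bracket. A Poisson bialgebra is a commutative bialgebra $B$ with a Poisson bracket (making it a Poisson algebra) such that the comultiplication $\Delta_B : B \to B\otimes B$ and the counit $\varepsilon_B : B \to k$ are morphisms of Poisson algebras. A Poisson Hopf algebra is a Poisson bialgebra whose underlying bialgebra is a Hopf algebra (i.e. has an antipode). A morphism of Poisson bialgebras is a map that is both a morphism of Poisson algebras and a morphism of coalgebras. The category of Poisson Hopf algebras is the full subcategory of the category of Poisson bialgebras whose objects are the Poisson Hopf algebras. A free Poisson Hopf algebra on a coalgebra $C$ is a Poisson Hopf algebra $G(C)$ with a coalgebra map $i : C \to G(C)$ such that for every Poisson Hopf algebra $H$ and every coalgebra map $f : C \to H$ there is a unique morphism of Poisson Hopf algebras $g : G(C)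 \to H$ with $g\circ i = f$. *)

(* Defs.v *)
From HB Require Import structures.
From mathcomp Require Import all_boot all_algebra.
From mathcomp Require Import boolp classical_sets.
From mathcomp Require Import ring.

Set Implicit Arguments.
Unset Strict Implicit.
Unset Printing Implicit Defensive.

Import GRing.Theory.

Local Open Scope ring_scope.
Local Open Scope quotient_scope.

Reserved Notation "v ⊗ w" (at level 40, left associativity).

(* MathComp has no tensor product of arbitrary (possibly infinite-dimensional)
   modules.  V ⊗ W is the set of formal sums of pairs (v, w), represented by
   lists, modulo the least congruence making concatenation commutative and
   (v, w) bilinear.  [teq_0] is not redundant: without it no nonempty list is
   identified with the empty one.  [tensor_ind] and [tlift_pure] below give the
   universal property. *)
Section TensorDef.
Variables (k : fieldType) (V W : lmodType k).

Inductive teq : seq (V * W) -> seq (V * W) -> Prop :=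
| teq_refl s : teq s s
| teq_sym s t : teq s t -> teq t s
| teq_trans s t u : teq s t -> teq t u -> teq s u
| teq_cat s s' t t' : teq s s' -> teq t t' -> teq (s ++ t) (s' ++ t')
| teq_catC s t : teq (s ++ t) (t ++ s)
| teq_0 w : teq [:: (0, w)] [::]
| teq_Dl v v' w : teq [:: (v + v', w)] [:: (v, w); (v', w)]
| teq_Dr v w w' : teq [:: (v, w + w')] [:: (v, w); (v, w')]
| teq_Z a v w : teq [:: (a *: v, w)] [:: (v, a *: w)].

Definition teqb : rel (seq (V * W)) := fun s t => `[< teq s t >].

Fact teqb_refl : reflexive teqb.
Proof. by move=> s; apply/asboolP/teq_refl. Qed.

Fact teqb_sym : symmetric teqb.
Proof. by move=> s t; apply/asboolP/asboolP => /teq_sym. Qed.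

Fact teqb_trans : transitive teqb.
Proof.
by move=> t s u /asboolP st /asboolP tu; apply/asboolP/(teq_trans st tu).
Qed.

Canonical teq_equiv := EquivRel teqb teqb_refl teqb_sym teqb_trans.

Definition tensor : Type := {eq_quot teq_equiv}.
HB.instance Definition _ := Choice.on tensor.

Implicit Types (s t : seq (V * W)) (x y z : tensor).

Definition tpi s : tensor := \pi_{eq_quot teq_equiv} s.
Definition trep x : seq (V * W) := repr (x : {eq_quot teq_equiv}).

Lemma trepK x : tpi (trep x) = x.
Proof. by rewrite /tpi /trep reprK. Qed.

Lemma tpiP s t : tpi s = tpi t <-> teq s t.
Proof.
by split=> [/eqmodP/asboolP // | st]; apply/eqmodP/asboolP.
Qed.

Lemma trep_pi s : teq (trep (tpi s)) s.
Proof. by apply/tpiP; rewrite trepK. Qed.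

Definition pure (v : V) (w : W) : tensor := tpi [:: (v, w)].

Definition tscale_seq (a : k) s := [seq (a *: p.1, p.2) | p <- s].

Definition tadd x y := tpi (trep x ++ trep y).
Definition tscale a x := tpi (tscale_seq a (trep x)).

Lemma tscale_teq a s t : teq s t -> teq (tscale_seq a s) (tscale_seq a t).
Proof.
elim=> {s t}.
- by move=> s; apply: teq_refl.
- by move=> s t _ /teq_sym.
- by move=> s t u _ st _ /(teq_trans st).
- by move=> s s' t t' _ ss _ tt; rewrite /tscale_seq !map_cat; apply: teq_cat.
- by move=> s t; rewrite /tscale_seq !map_cat; apply: teq_catC.
- by move=> w; rewrite /tscale_seq /= scaler0; apply: teq_0.
- by move=> v v' w; rewrite /tscale_seq /= scalerDr; apply: teq_Dl.
- by move=> v w w'; apply: teq_Dr.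
- by move=> b v w; rewrite /tscale_seq /= scalerA mulrC -scalerA; apply: teq_Z.
Qed.

Lemma tadd_pi s t : tadd (tpi s) (tpi t) = tpi (s ++ t).
Proof. by apply/tpiP/teq_cat; apply: trep_pi. Qed.

Lemma tscale_pi a s : tscale a (tpi s) = tpi (tscale_seq a s).
Proof. by apply/tpiP/tscale_teq/trep_pi. Qed.

Fact taddA : associative tadd.
Proof.
move=> x y z; rewrite -(trepK x) -(trepK y) -(trepK z).
by rewrite !tadd_pi catA.
Qed.

Fact taddC : commutative tadd.
Proof.
by move=> x y; rewrite -(trepK x) -(trepK y) !tadd_pi; apply/tpiP/teq_catC.
Qed.

Fact tadd0 : left_id (tpi [::]) tadd.
Proof. by move=> x; rewrite -(trepK x) tadd_pi. Qed.

Lemma tscale_nil s : teq (tscale_seq 0 s) [::].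
Proof.
elim: s => [|[v w] s IHs]; first exact: teq_refl.
rewrite /tscale_seq /= scale0r.
exact: (teq_cat (s := [:: _]) (s' := [::]) (teq_0 w) IHs).
Qed.

Lemma tscaleDl_seq a b s :
  teq (tscale_seq (a + b) s) (tscale_seq a s ++ tscale_seq b s).
Proof.
elim: s => [|[v w] s IHs]; first exact: teq_refl.
rewrite /tscale_seq /= scalerDl.
apply: (teq_trans (teq_cat (s := [:: _]) (teq_Dl _ _ _) IHs)) => /=.
rewrite -cat1s -[X in teq _ X]cat1s; apply: teq_cat; first exact: teq_refl.
rewrite -cat1s -/(tscale_seq a s) -/(tscale_seq b s) catA.
rewrite -[X in teq _ (_ ++ X)]cat1s catA.
by apply: teq_cat; [exact: teq_catC | exact: teq_refl].
Qed.

Fact taddN : left_inverse (tpi [::]) (tscale (-1)) tadd.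
Proof.
move=> x; rewrite -(trepK x) tscale_pi tadd_pi; apply/tpiP.
have {2}-> : trep x = tscale_seq 1 (trep x).
  by rewrite /tscale_seq -[LHS]map_id; apply: eq_map => -[v w]; rewrite scale1r.
apply: teq_trans (teq_sym (tscaleDl_seq _ _ _)) _.
by rewrite addNr; apply: tscale_nil.
Qed.

HB.instance Definition _ := GRing.isZmodule.Build tensor taddA taddC tadd0 taddN.

Lemma tpi_cat s t : tpi (s ++ t) = tpi s + tpi t.
Proof. by rewrite -tadd_pi. Qed.

Fact tscaleA a b x : tscale a (tscale b x) = tscale (a * b) x.
Proof.
rewrite -(trepK x) !tscale_pi /tscale_seq -map_comp.
by congr tpi; apply: eq_map => -[v w] /=; rewrite scalerA.
Qed.

Fact tscale1 : left_id 1 tscale.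
Proof.
move=> x; rewrite -(trepK x) tscale_pi /tscale_seq; congr tpi.
by rewrite -[RHS]map_id; apply: eq_map => -[v w]; rewrite scale1r.
Qed.

Fact tscaleDr : right_distributive tscale +%R.
Proof.
move=> a x y; rewrite -(trepK x) -(trepK y) -tpi_cat !tscale_pi -tpi_cat.
by rewrite /tscale_seq map_cat.
Qed.

Fact tscaleDl x : {morph tscale^~ x : a b / a + b}.
Proof.
move=> a b; rewrite -(trepK x) !tscale_pi -tpi_cat.
exact/tpiP/tscaleDl_seq.
Qed.

HB.instance Definition _ :=
  GRing.Zmodule_isLmodule.Build k tensor tscaleA tscale1 tscaleDr tscaleDl.

Fact pure_bilinear : bilinear_for *:%R *:%R pure.
Proof.
have scE a v w : pure (a *: v) w = a *: pure v w.
  by rewrite [RHS]tscale_pi.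
split=> [w a v v' | v a w w'] /=.
  rewrite -scE /pure -tpi_cat; exact/tpiP/teq_Dl.
rewrite -scE /pure -tpi_cat; apply/tpiP.
apply: teq_trans (teq_Dr _ _ _) _.
apply: (teq_cat (s := [:: _]) (t := [:: _])); last exact: teq_refl.
exact/teq_sym/teq_Z.
Qed.

HB.instance Definition _ :=
  bilinear_isBilinear.Build k V W tensor *:%R *:%R pure pure_bilinear.

Lemma purePl a v v' w : pure (a *: v + v') w = a *: pure v w + pure v' w.
Proof. exact: linearPl. Qed.

Lemma purePr v a w w' : pure v (a *: w + w') = a *: pure v w + pure v w'.
Proof. exact: linearPr. Qed.

Lemma pureDl v v' w : pure (v + v') w = pure v w + pure v' w.
Proof. exact: linearDl. Qed.

Lemma pureDr v w w' : pure v (w + w') = pure v w + pure v w'.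
Proof. exact: linearDr. Qed.

Lemma pureZl a v w : pure (a *: v) w = a *: pure v w.
Proof. exact: linearZl_LR. Qed.

Lemma pureZr a v w : pure v (a *: w) = a *: pure v w.
Proof. exact: linearZr_LR. Qed.

Lemma pure0l w : pure 0 w = 0.
Proof. exact: linear0l. Qed.

Lemma pure0r v : pure v 0 = 0.
Proof. exact: linear0r. Qed.

Lemma tpi_sum s : tpi s = \sum_(p <- s) pure p.1 p.2.
Proof.
elim: s => [|[v w] s IHs]; first by rewrite big_nil.
by rewrite big_cons -cat1s tpi_cat IHs.
Qed.

Lemma tensor_ind (P : tensor -> Prop) :
  (forall v w, P (pure v w)) -> (forall x y, P x -> P y -> P (x + y)) ->
  forall x, P x.
Proof.
move=> Pp PD x; rewrite -(trepK x); elim: (trep x) => [|[v w] s IHs].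
  have -> : tpi [::] = pure 0 0 by apply/tpiP/teq_sym/teq_0.
  exact: Pp.
by rewrite -cat1s tpi_cat; apply: PD; [exact: Pp | exact: IHs].
Qed.

End TensorDef.

Arguments pure {k V W} v w.

Notation "V ⊗ W" := (tensor V%type W%type) : type_scope.
Notation "v ⊗ w" := (pure v w) : ring_scope.

Section TensorLift.
Variables (k : fieldType) (V W U : lmodType k) (b : {bilinear V -> W -> U}).

Definition tlift (x : V ⊗ W) : U := \sum_(p <- trep x) b p.1 p.2.

Lemma tlift_teq (s t : seq (V * W)) : teq s t ->
  \sum_(p <- s) b p.1 p.2 = \sum_(p <- t) b p.1 p.2.
Proof.
elim=> {s t}.
- by [].
- by move=> s t _ ->.
- by move=> s t u _ -> _ ->.
- by move=> s s' t t' _ IHs _ IHt; rewrite !big_cat /= IHs IHt.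
- by move=> s t; rewrite !big_cat /= addrC.
- by move=> w; rewrite big_seq1 big_nil /= linear0l.
- by move=> v v' w; rewrite !big_cons !big_nil !addr0 /= linearDl.
- by move=> v w w'; rewrite !big_cons !big_nil !addr0 /= linearDr.
- by move=> a v w; rewrite !big_seq1 /= linearZl_LR linearZr_LR.
Qed.

Lemma tlift_pi s : tlift (tpi s) = \sum_(p <- s) b p.1 p.2.
Proof. exact/tlift_teq/trep_pi. Qed.

Fact tlift_linear : linear tlift.
Proof.
move=> a x y; rewrite -(trepK x) -(trepK y).
have -> : a *: tpi (trep x) = tpi (tscale_seq a (trep x)) by rewrite [LHS]tscale_pi.
rewrite -tpi_cat !tlift_pi big_cat /= big_map scaler_sumr.
by congr (_ + _); apply: eq_bigr => p _; rewrite linearZl_LR.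
Qed.

HB.instance Definition _ := GRing.isLinear.Build k (tensor V W) U *:%R tlift tlift_linear.

Lemma tlift_pure v w : tlift (v ⊗ w) = b v w.
Proof. by rewrite [LHS]tlift_pi big_seq1. Qed.

Lemma tliftD x y : tlift (x + y) = tlift x + tlift y.
Proof. exact: linearD. Qed.

End TensorLift.

Section TensorMap.
Variables (k : fieldType) (V V' W W' : lmodType k).
Variables (f : {linear V -> V'}) (g : {linear W -> W'}).

Definition tmap_pure (v : V) (w : W) : V' ⊗ W' := f v ⊗ g w.

Fact tmap_pure_bilinear : bilinear_for *:%R *:%R tmap_pure.
Proof.
by split=> [w a v v' | v a w w']; rewrite /tmap_pure linearP ?linearPl ?linearPr.
Qed.

HB.instance Definition _ :=
  bilinear_isBilinear.Build k V W (tensor V' W') *:%R *:%R tmap_pure tmap_pure_bilinear.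

Definition tmap : V ⊗ W -> V' ⊗ W' := tlift tmap_pure.

HB.instance Definition _ := GRing.Linear.on tmap.

Lemma tmap_pureE v w : tmap (v ⊗ w) = f v ⊗ g w.
Proof. exact: tlift_pure. Qed.

Lemma tmapD x y : tmap (x + y) = tmap x + tmap y.
Proof. exact: linearD. Qed.

End TensorMap.

Section TensorAssoc.
Variables (k : fieldType) (U V W : lmodType k).

Definition tassoc_pure (t : U ⊗ V) (w : W) : U ⊗ (V ⊗ W) :=
  tmap idfun (applyr pure w) t.

Fact tassoc_pure_bilinear : bilinear_for *:%R *:%R tassoc_pure.
Proof.
split=> [w | t a w w'] /=; first exact: linearP.
rewrite /tassoc_pure; elim/tensor_ind: t => [u v|s t IHs IHt].
  by rewrite !tmap_pureE /= /applyr !purePr.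
by rewrite !tmapD IHs IHt scalerDr addrACA.
Qed.

HB.instance Definition _ :=
  bilinear_isBilinear.Build k (tensor U V) W (tensor U (tensor V W))
    *:%R *:%R tassoc_pure tassoc_pure_bilinear.

Definition tassoc : (U ⊗ V) ⊗ W -> U ⊗ (V ⊗ W) := tlift tassoc_pure.

HB.instance Definition _ := GRing.Linear.on tassoc.

Lemma tassoc_pureE u v w : tassoc (u ⊗ v ⊗ w) = u ⊗ (v ⊗ w).
Proof. by rewrite /tassoc tlift_pure /= /tassoc_pure tmap_pureE. Qed.

End TensorAssoc.

Section TensorBilin.
Variables (k : fieldType) (V W : lmodType k).
Variables (b : {bilinear V -> V -> V}) (c : {bilinear W -> W -> W}).

Definition tbilin_pure (u : V ⊗ W) (v : V) (w : W) : V ⊗ W :=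
  tmap (b v) (c w) u.

Fact tbilin_pure_bilinear u : bilinear_for *:%R *:%R (tbilin_pure u).
Proof.
rewrite /tbilin_pure; split=> [w a v v' | v a w w'] /=.
  elim/tensor_ind: u => [x y|s t IHs IHt].
    by rewrite !tmap_pureE /= linearPl purePl.
  by rewrite !tmapD IHs IHt scalerDr addrACA.
elim/tensor_ind: u => [x y|s t IHs IHt].
  by rewrite !tmap_pureE /= linearPl purePr.
by rewrite !tmapD IHs IHt scalerDr addrACA.
Qed.

HB.instance Definition _ u :=
  bilinear_isBilinear.Build k V W (tensor V W) *:%R *:%R (tbilin_pure u)
    (tbilin_pure_bilinear u).

Definition tbilin (t u : V ⊗ W) : V ⊗ W := tlift (tbilin_pure u) t.

Lemma tbilin_pureE v w v' w' : tbilin (v ⊗ w) (v' ⊗ w') = b v v' ⊗ c w w'.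
Proof. by rewrite /tbilin tlift_pure /= /tbilin_pure tmap_pureE. Qed.

Fact tbilin_bilinear : bilinear_for *:%R *:%R tbilin.
Proof.
rewrite /tbilin; split=> [u a t t' | t a u u'] /=; first exact: linearP.
elim/tensor_ind: t => [v w|s t IHs IHt].
  by rewrite !tlift_pure /= /tbilin_pure linearP.
by rewrite !tliftD IHs IHt scalerDr addrACA.
Qed.

HB.instance Definition _ :=
  bilinear_isBilinear.Build k (tensor V W) (tensor V W) (tensor V W) *:%R *:%R
    tbilin tbilin_bilinear.

Lemma tbilinPl a x x' y :
  tbilin (a *: x + x') y = a *: tbilin x y + tbilin x' y.
Proof. exact: linearPl. Qed.

Lemma tbilinPr x a y y' :
  tbilin x (a *: y + y') = a *: tbilin x y + tbilin x y'.
Proof. exact: linearPr. Qed.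

Lemma tbilinDl x x' y : tbilin (x + x') y = tbilin x y + tbilin x' y.
Proof. exact: linearDl. Qed.

Lemma tbilinDr x y y' : tbilin x (y + y') = tbilin x y + tbilin x y'.
Proof. exact: linearDr. Qed.

Lemma tbilinZl a x y : tbilin (a *: x) y = a *: tbilin x y.
Proof. exact: linearZl_LR. Qed.

End TensorBilin.

(* Nonzero vectors have a nonzero tensor product, so that the tensor product of
   two (nonzero) algebras is a nonzero algebra, as comAlgType requires. *)
Section TensorNeq0.
Variable k : fieldType.

Lemma linear_functional (V : lmodType k) (v0 : V) :
  v0 != 0 -> exists f : {linear V -> k^o}, f v0 = 1.
Proof.
move=> v0n0.
pose P : set (set V) := fun A =>
  (forall (a : k) u v, A u -> A v -> A (a *: u + v)) /\ ~ A v0.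
have [F FP Ftot|M [[ML Mv0] Mmax]] := @Zorn_bigcup V P.
  split=> [a u v [X FX Xu] [Y FY Yv]|[X FX Xv0]]; last first.
    by have [_] := FP _ FX; apply.
  have [XY|YX] := Ftot _ _ FX FY.
    by exists Y => //; have [YL _] := FP _ FY; apply: YL => //; apply: XY.
  by exists X => //; have [XL _] := FP _ FX; apply: XL => //; apply: YX.
have M0 : M 0.
  have [[u Mu]|M_0] := pselect (exists u, M u).
    by have := ML (-1) _ _ Mu Mu; rewrite scaleN1r addNr.
  case: (Mmax [set 0]%classic); first split.
  - by move=> u Mu; case: M_0; exists u.
  - by move=> sM; apply: M_0; exists 0; apply: sM.
  split=> [a _ _ -> -> /=|]; first by rewrite scaler0 addr0.
  by move/eqP; rewrite (negPf v0n0).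
have MZ (a : k) u : M u -> M (a *: u).
  by move=> Mu; have := ML a _ _ Mu M0; rewrite addr0.
have MD u v : M u -> M v -> M (u + v).
  by move=> Mu Mv; have := ML 1 _ _ Mu Mv; rewrite scale1r.
have ex x : exists c : k, M (x - c *: v0).
  have [Mx|nMx] := pselect (M x); first by exists 0; rewrite scale0r subr0.
  pose B : set V := fun y => exists m (a : k), M m /\ y = m + a *: x.
  have BP : ~ P B.
    apply: Mmax; split=> [m Mm|sBM].
      by exists m, 0; rewrite scale0r addr0.
    by apply/nMx/sBM; exists 0, 1; rewrite scale1r add0r.
  have [Bv0|nBv0] := pselect (B v0); last first.
    case: BP; split=> // a _ _ [m [b [Mm ->]]] [m' [b' [Mm' ->]]].
    exists (a *: m + m'), (a * b + b'); split; first exact: ML.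
    by rewrite scalerDr scalerA addrACA scalerDl.
  have [m [a [Mm v0E]]] := Bv0.
  have a0 : a != 0.
    apply/eqP => a0; apply: Mv0.
    by rewrite v0E a0 scale0r addr0.
  exists a^-1; rewrite v0E scalerDr scalerA mulVf // scale1r opprD addrCA subrr.
  by rewrite addr0 -scaleN1r; apply/MZ/MZ.
have uniq (c d : k) x : M (x - c *: v0) -> M (x - d *: v0) -> c = d.
  move=> Mc Md; apply/eqP/negPn/negP => cd; apply: Mv0.
  have := MD _ _ (MZ (-1) _ Mc) Md.
  rewrite scaleN1r opprB addrA subrK -scalerBl => /(MZ (c - d)^-1).
  by rewrite scalerA mulVf ?scale1r // subr_eq0.
have [f fP] := choice ex.
have fL : linear (f : V -> k^o).
  move=> a x y; apply: uniq (fP _) _.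
  have := ML a _ _ (fP x) (fP y).
  by rewrite scalerBr scalerA addrACA -opprD -scalerDl.
pose fM := GRing.isLinear.Build k V k^o *:%R f fL.
pose g : {linear V -> k^o} := HB.pack (f : V -> k^o) fM.
exists g.
apply: (uniq _ _ v0) => /=; first exact: fP.
by rewrite scale1r subrr.
Qed.

Variables (V W : lmodType k) (f : {linear V -> k^o}).

Definition contract_pure (v : V) (w : W) : W := (f v : k) *: w.

Fact contract_pure_bilinear : bilinear_for *:%R *:%R contract_pure.
Proof.
split=> [w a v v' | v a w w'] /=; rewrite /contract_pure.
  by rewrite linearP scalerDl -scalerA.
by rewrite scalerDr !scalerA mulrC.
Qed.

HB.instance Definition _ :=
  bilinear_isBilinear.Build k V W W *:%R *:%R
    contract_pure contract_pure_bilinear.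

End TensorNeq0.

Lemma pure_neq0 (k : fieldType) (V W : lmodType k) (v : V) (w : W) :
  v != 0 -> w != 0 -> v ⊗ w != 0.
Proof.
move=> /linear_functional[f fv] w0; apply/eqP => vw0.
have := tlift_pure (contract_pure (W := W) f) v w.
rewrite vw0 linear0 /= /contract_pure fv scale1r => w0E.
by rewrite -w0E eqxx in w0.
Qed.

Section MulBilinear.
Variables (k : fieldType) (A : comAlgType k).

Fact mul_bilinear : bilinear_for *:%R *:%R (@GRing.mul A).
Proof.
split=> [y a x x' | x a y y'] /=; first by rewrite mulrDl scalerAl.
by rewrite mulrDr scalerAr.
Qed.

HB.instance Definition _ :=
  bilinear_isBilinear.Build k A A A *:%R *:%R (@GRing.mul A) mul_bilinear.

End MulBilinear.

Section TensorAlgebra.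
Variables (k : fieldType) (A B : comAlgType k).

Definition tmul : A ⊗ B -> A ⊗ B -> A ⊗ B := tbilin *%R *%R.

Lemma tmul_pure a b a' b' : tmul (a ⊗ b) (a' ⊗ b') = (a * a') ⊗ (b * b').
Proof. exact: tbilin_pureE. Qed.

Lemma tmulDl : left_distributive tmul +%R.
Proof. by move=> x y z; exact: tbilinDl. Qed.

Lemma tmulDr : right_distributive tmul +%R.
Proof. by move=> x y z; exact: tbilinDr. Qed.

Fact tmulA : associative tmul.
Proof.
elim/tensor_ind=> [a b y z|x x' IHx IHx' y z]; last first.
  by rewrite !tmulDl IHx IHx'.
elim/tensor_ind: y => [a' b'|y y' IHy IHy']; last first.
  by rewrite !(tmulDl, tmulDr) IHy IHy'.
elim/tensor_ind: z => [a'' b''|z z' IHz IHz']; last first.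
  by rewrite !tmulDr IHz IHz'.
by rewrite !tmul_pure !mulrA.
Qed.

Fact tmulC : commutative tmul.
Proof.
elim/tensor_ind=> [a b y|x x' IHx IHx' y]; last first.
  by rewrite tmulDl tmulDr IHx IHx'.
elim/tensor_ind: y => [a' b'|y y' IHy IHy']; last first.
  by rewrite tmulDl tmulDr IHy IHy'.
by rewrite !tmul_pure mulrC [b * _]mulrC.
Qed.

Fact tmul1 : left_id (1 ⊗ 1) tmul.
Proof.
elim/tensor_ind=> [a b|x y IHx IHy]; first by rewrite tmul_pure !mul1r.
by rewrite tmulDr IHx IHy.
Qed.

Fact tone_neq0 : (1 : A) ⊗ (1 : B) != 0.
Proof. exact: pure_neq0 (oner_neq0 _) (oner_neq0 _). Qed.

HB.instance Definition _ := GRing.Zmodule_isComNzRing.Build (tensor A B)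
  tmulA tmulC tmul1 tmulDl tone_neq0.

Fact tmul_scalerAl (a : k) (x y : A ⊗ B) : a *: (x * y) = (a *: x) * y.
Proof. by rewrite [RHS]tbilinZl. Qed.

HB.instance Definition _ :=
  GRing.Lmodule_isLalgebra.Build k (tensor A B) tmul_scalerAl.
HB.instance Definition _ := GRing.Lalgebra_isComAlgebra.Build k (tensor A B).

Lemma mul_pure (a a' : A) (b b' : B) :
  (a ⊗ b) * (a' ⊗ b') = (a * a') ⊗ (b * b').
Proof. exact: tmul_pure. Qed.

Lemma one_pure : 1 = (1 : A) ⊗ (1 : B).
Proof. by []. Qed.

End TensorAlgebra.

(* Bilinearity, the Lie algebra axioms and the Leibniz rule.  The bracket is
   required to be alternating because k may have characteristic 2.  As for
   every comAlgType, the zero algebra is excluded; a Poisson bialgebra is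
   never zero, its counit being unital. *)
HB.mixin Record isPoisson (k : fieldType) P of GRing.ComAlgebra k P := {
  bracket : {bilinear P -> P -> P};
  bracketxx : forall x : P, bracket x x = 0;
  bracket_jacobi : forall x y z : P,
    bracket x (bracket y z) + bracket y (bracket z x) + bracket z (bracket x y)
      = 0;
  bracket_leibniz : forall p q r : P,
    bracket p (q * r) = bracket p q * r + q * bracket p r
}.

#[short(type="poissonAlgType")]
HB.structure Definition PoissonAlgebra (k : fieldType) :=
  {P of GRing.ComAlgebra k P & isPoisson k P}.

Section PoissonTheory.
Variables (k : fieldType) (P : poissonAlgType k).

Lemma bracketC (x y : P) : bracket x y = - bracket y x.
Proof.
have := bracketxx (x + y).
rewrite linearDl !linearDr !bracketxx add0r addr0 => /eqP.
by rewrite addr_eq0 => /eqP.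
Qed.

Lemma bracket_leibnizl (p q r : P) :
  bracket (p * q) r = bracket p r * q + p * bracket q r.
Proof.
rewrite bracketC bracket_leibniz opprD -mulNr -mulrN.
by rewrite -!(bracketC _ r).
Qed.

End PoissonTheory.

Section RegularPoisson.
Variable k : fieldType.

Definition bracket0 (x y : k^o) : k^o := 0.

Fact bracket0_bilinear : bilinear_for *:%R *:%R bracket0.
Proof. by split=> [? a x y | ? a x y]; rewrite /bracket0 /= scaler0 addr0. Qed.

HB.instance Definition _ := bilinear_isBilinear.Build k k^o k^o k^o *:%R *:%R
  bracket0 bracket0_bilinear.

Fact bracket0xx x : bracket0 x x = 0. Proof. by []. Qed.

Fact bracket0_jacobi x y z :
  bracket0 x (bracket0 y z) + bracket0 y (bracket0 z x)
  + bracket0 z (bracket0 x y) = 0.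
Proof. by rewrite /bracket0 !addr0. Qed.

Fact bracket0_leibniz p q r :
  bracket0 p (q * r) = bracket0 p q * r + q * bracket0 p r.
Proof. by rewrite /bracket0 mulr0 mul0r addr0. Qed.

HB.instance Definition _ :=
  isPoisson.Build k k^o bracket0xx bracket0_jacobi bracket0_leibniz.

End RegularPoisson.

Section TensorPoisson.
Variables (k : fieldType) (P Q : poissonAlgType k).

Definition tbracket (x y : P ⊗ Q) : P ⊗ Q :=
  tbilin *%R bracket x y + tbilin bracket *%R x y.

Fact tbracket_bilinear : bilinear_for *:%R *:%R tbracket.
Proof.
split=> [y a x x' | x a y y'] /=; rewrite /tbracket.
  by rewrite !tbilinPl scalerDr addrACA.
by rewrite !tbilinPr scalerDr addrACA.
Qed.

HB.instance Definition _ :=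
  bilinear_isBilinear.Build k (tensor P Q) (tensor P Q) (tensor P Q) *:%R *:%R
    tbracket tbracket_bilinear.

Lemma tbracket_pure p q r s :
  tbracket (p ⊗ q) (r ⊗ s) = (p * r) ⊗ bracket q s + bracket p r ⊗ (q * s).
Proof. by rewrite /tbracket !tbilin_pureE. Qed.

Lemma tbracketDl x x' y : tbracket (x + x') y = tbracket x y + tbracket x' y.
Proof. exact: (linearDl tbracket). Qed.

Lemma tbracketDr x y y' : tbracket x (y + y') = tbracket x y + tbracket x y'.
Proof. exact: (linearDr tbracket). Qed.

Lemma tbracketC x y : tbracket x y = - tbracket y x.
Proof.
elim/tensor_ind: x => [p q|x x' IHx IHx']; last first.
  by rewrite tbracketDl tbracketDr opprD IHx IHx'.
elim/tensor_ind: y => [r s|y y' IHy IHy']; last first.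
  by rewrite tbracketDl tbracketDr opprD IHy IHy'.
rewrite !tbracket_pure opprD (mulrC p) (mulrC q).
by rewrite (bracketC q) (bracketC p) -!scaleN1r pureZl pureZr.
Qed.

Fact tbracketxx x : tbracket x x = 0.
Proof.
elim/tensor_ind: x => [p q|x x' IHx IHx'].
  by rewrite tbracket_pure !bracketxx pure0l pure0r addr0.
rewrite tbracketDl !tbracketDr IHx IHx' add0r addr0.
by rewrite [X in X + _]tbracketC addNr.
Qed.

Fact tbracket_leibniz (x y z : P ⊗ Q) :
  tbracket x (y * z) = tbracket x y * z + y * tbracket x z.
Proof.
elim/tensor_ind: x => [p q|x x' IHx IHx']; last first.
  by rewrite !tbracketDl mulrDl mulrDr IHx IHx' addrACA.
elim/tensor_ind: y => [r s|y y' IHy IHy']; last first.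
  by rewrite (mulrDl y) !tbracketDr IHy IHy'; ring.
elim/tensor_ind: z => [t u|z z' IHz IHz']; last first.
  by rewrite (mulrDr (r ⊗ s)) !tbracketDr IHz IHz'; ring.
rewrite mul_pure !tbracket_pure mulrDl mulrDr !mul_pure.
rewrite !bracket_leibniz pureDl pureDr !mulrA.
by rewrite (mulrC r p) (mulrC s q); ring.
Qed.

Lemma pureNl (v : P) (w : Q) : (- v) ⊗ w = - (v ⊗ w).
Proof. by rewrite -scaleN1r pureZl scaleN1r. Qed.

Lemma pureNr (v : P) (w : Q) : v ⊗ (- w) = - (v ⊗ w).
Proof. by rewrite -scaleN1r pureZr scaleN1r. Qed.

Lemma tbracket_bracket_pure (a b c : P) (p q r : Q) :
  tbracket (a ⊗ p) (tbracket (b ⊗ q) (c ⊗ r)) =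
    (a * b * c) ⊗ bracket p (bracket q r)
    + bracket a (bracket b c) ⊗ (p * q * r)
    + (c * bracket a b) ⊗ (p * bracket q r)
    - (b * bracket c a) ⊗ (p * bracket q r)
    + (a * bracket b c) ⊗ (r * bracket p q)
    - (a * bracket b c) ⊗ (q * bracket r p).
Proof.
rewrite tbracket_pure tbracketDr !tbracket_pure !bracket_leibniz.
rewrite pureDl pureDr !mulrA (bracketC c a) (bracketC r p) !mulrN pureNl pureNr.
by rewrite (mulrC _ (bracket a b)) (mulrC _ (bracket p q)); ring.
Qed.

Let jacobiator (x y z : P ⊗ Q) : P ⊗ Q :=
  tbracket x (tbracket y z) + tbracket y (tbracket z x)
  + tbracket z (tbracket x y).

Lemma jacobiator_rot x y z : jacobiator x y z = jacobiator y z x.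
Proof. by rewrite /jacobiator -[LHS]addrA [RHS]addrC. Qed.

Lemma jacobiatorD (x x' y z : P ⊗ Q) :
  jacobiator (x + x') y z = jacobiator x y z + jacobiator x' y z.
Proof.
rewrite /jacobiator (tbracketDl x x' (tbracket y z)) (tbracketDr z x x').
rewrite (tbracketDr y (tbracket z x) (tbracket z x')) (tbracketDl x x' y).
rewrite (tbracketDr z (tbracket x y) (tbracket x' y)).
by rewrite [X in X + _ = _]addrACA [LHS]addrACA.
Qed.

Fact tbracket_jacobi x y z : jacobiator x y z = 0.
Proof.
elim/tensor_ind: x => [a p|x x' IHx IHx']; last first.
  by rewrite jacobiatorD IHx IHx' addr0.
rewrite jacobiator_rot; elim/tensor_ind: y => [b q|y y' IHy IHy']; last first.
  by rewrite jacobiatorD IHy IHy' addr0.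
rewrite jacobiator_rot; elim/tensor_ind: z => [c r|z z' IHz IHz']; last first.
  by rewrite jacobiatorD IHz IHz' addr0.
rewrite jacobiator_rot /jacobiator.
have -> : 0 = (a * b * c) ⊗ 0 + 0 ⊗ (p * q * r) :> P ⊗ Q.
  by rewrite pure0l pure0r addr0.
rewrite -(bracket_jacobi a b c) -(bracket_jacobi p q r) !pureDl !pureDr.
rewrite !tbracket_bracket_pure (mulrC (b * c) a) (mulrC (q * r) p).
rewrite -(mulrA c a b) (mulrC c (a * b)) -(mulrA r p q) (mulrC r (p * q)) !mulrA.
by ring.
Qed.

HB.instance Definition _ :=
  isPoisson.Build k (tensor P Q) tbracketxx tbracket_jacobi tbracket_leibniz.

Lemma bracket_pure (p r : P) (q s : Q) :
  bracket (p ⊗ q) (r ⊗ s) = (p * r) ⊗ bracket q s + bracket p r ⊗ (q * s).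
Proof. exact: tbracket_pure. Qed.

End TensorPoisson.

(* The counit axioms (id ⊗ ε) Δ = id = (ε ⊗ id) Δ are stated through the
   canonical isomorphisms x |-> x ⊗ 1 and x |-> 1 ⊗ x. *)
HB.mixin Record isCoalgebra (k : fieldType) C of GRing.Lmodule k C := {
  comul : {linear C -> (C ⊗ C)%type};
  counit : {linear C -> k^o};
  comulA : forall x : C,
    tassoc (tmap comul idfun (comul x)) = tmap idfun comul (comul x);
  comul_counitl : forall x : C,
    tmap counit idfun (comul x) = (1 : k^o) ⊗ x;
  comul_counitr : forall x : C,
    tmap idfun counit (comul x) = x ⊗ (1 : k^o)
}.

#[short(type="coalgType")]
HB.structure Definition Coalgebra (k : fieldType) :=
  {C of GRing.Lmodule k C & isCoalgebra k C}.

Definition is_coalgebra_morphism (k : fieldType) (C D : coalgType k)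
    (f : {linear C -> D}) : Prop :=
  (forall x, comul (f x) = tmap f f (comul x)) /\
  (forall x, counit (f x) = counit x).

Definition is_poisson_morphism (k : fieldType) (P Q : poissonAlgType k)
    (f : {linear P -> Q}) : Prop :=
  monoid_morphism f /\ {morph f : x y / bracket x y}.

HB.mixin Record isPoissonBialgebra (k : fieldType) B
    of PoissonAlgebra k B & Coalgebra k B := {
  comul_poisson : is_poisson_morphism (comul : {linear B -> (B ⊗ B)%type});
  counit_poisson : is_poisson_morphism (counit : {linear B -> k^o})
}.

#[short(type="poissonBialgType")]
HB.structure Definition PoissonBialgebra (k : fieldType) :=
  {B of PoissonAlgebra k B & Coalgebra k B & isPoissonBialgebra k B}.

Definition is_antipode (k : fieldType) (B : poissonBialgType k)
    (S : {linear B -> B}) : Prop :=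
  (forall x : B, tlift *%R (tmap S idfun (comul x)) = (counit x : k)%:A) /\
  (forall x : B, tlift *%R (tmap idfun S (comul x)) = (counit x : k)%:A).

HB.mixin Record hasAntipode (k : fieldType) H of PoissonBialgebra k H := {
  antipode_ex : exists S : {linear H -> H}, is_antipode S
}.

#[short(type="poissonHopfType")]
HB.structure Definition PoissonHopf (k : fieldType) :=
  {H of PoissonBialgebra k H & hasAntipode k H}.

Record coalgHom (k : fieldType) (C D : coalgType k) := CoalgHom {
  coalg_fun :> {linear C -> D};
  coalg_funP : is_coalgebra_morphism coalg_fun
}.

Record poissonBialgHom (k : fieldType) (A B : poissonBialgType k) :=
  PoissonBialgHom {
    pbialg_fun :> {linear A -> B};
    pbialg_poisson : is_poisson_morphism pbialg_fun;
    pbialg_coalg : is_coalgebra_morphism pbialg_fun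
  }.

Section HomTheory.
Variable k : fieldType.

Lemma linear_ext (V W : lmodType k) (f g : {linear V -> W}) :
  f =1 g -> f = g.
Proof.
case: f g => [f [[fD] [fZ]]] [g [[gD] [gZ]]] /= /funext fg.
case: _ / fg in gD gZ *.
by rewrite (Prop_irrelevance gD fD) (Prop_irrelevance gZ fZ).
Qed.

Lemma coalgHom_ext (C D : coalgType k) (f g : coalgHom C D) :
  f =1 g -> f = g.
Proof.
case: f g => [f fP] [g gP] /= /linear_ext fg.
by case: _ / fg in gP *; rewrite (Prop_irrelevance gP fP).
Qed.

Lemma poissonBialgHom_ext (A B : poissonBialgType k)
  (f g : poissonBialgHom A B) : f =1 g -> f = g.
Proof.
case: f g => [f fP fC] [g gP gC] /= /linear_ext fg.
case: _ / fg in gP gC *.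
by rewrite (Prop_irrelevance gP fP) (Prop_irrelevance gC fC).
Qed.

Lemma tmap_id (V W : lmodType k) (x : V ⊗ W) : tmap idfun idfun x = x.
Proof.
by elim/tensor_ind: x => [v w|x y IHx IHy]; rewrite ?tmap_pureE ?tmapD ?IHx ?IHy.
Qed.

Lemma tmap_comp (U V W U' V' W' : lmodType k)
    (f : {linear U -> V}) (g : {linear V -> W})
    (f' : {linear U' -> V'}) (g' : {linear V' -> W'}) (x : U ⊗ U') :
  tmap (g \o f) (g' \o f') x = tmap g g' (tmap f f' x).
Proof.
elim/tensor_ind: x => [v w|x y IHx IHy]; first by rewrite !tmap_pureE.
by rewrite !tmapD IHx IHy.
Qed.

Fact id_is_coalgebra_morphism (C : coalgType k) :
  is_coalgebra_morphism (idfun : {linear C -> C}).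
Proof. by split=> // x; rewrite tmap_id. Qed.

Fact comp_is_coalgebra_morphism (C D E : coalgType k)
    (g : {linear D -> E}) (f : {linear C -> D}) :
  is_coalgebra_morphism g -> is_coalgebra_morphism f ->
  is_coalgebra_morphism (g \o f : {linear C -> E}).
Proof.
move=> [gm gu] [fm fu]; split=> x /=; last by rewrite gu fu.
by rewrite gm fm tmap_comp.
Qed.

Fact id_is_poisson_morphism (P : poissonAlgType k) :
  is_poisson_morphism (idfun : {linear P -> P}).
Proof. by []. Qed.

Fact comp_is_poisson_morphism (P Q R : poissonAlgType k)
    (g : {linear Q -> R}) (f : {linear P -> Q}) :
  is_poisson_morphism g -> is_poisson_morphism f ->
  is_poisson_morphism (g \o f : {linear P -> R}).
Proof.
move=> [[g1 gM] gB] [[f1 fM] fB]; split; last by move=> x y /=; rewrite fB gB.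
by split=> [|x y] /=; rewrite ?f1 ?fM ?gM.
Qed.

Definition coalg_id (C : coalgType k) : coalgHom C C :=
  CoalgHom (id_is_coalgebra_morphism C).

Definition coalg_comp (C D E : coalgType k)
    (g : coalgHom D E) (f : coalgHom C D) : coalgHom C E :=
  CoalgHom (comp_is_coalgebra_morphism (coalg_funP g) (coalg_funP f)).

Definition pbialg_id (A : poissonBialgType k) : poissonBialgHom A A :=
  PoissonBialgHom (id_is_poisson_morphism A) (id_is_coalgebra_morphism A).

Definition pbialg_comp (A B C : poissonBialgType k)
    (g : poissonBialgHom B C) (f : poissonBialgHom A B) : poissonBialgHom A C :=
  PoissonBialgHom
    (comp_is_poisson_morphism (pbialg_poisson g) (pbialg_poisson f))
    (comp_is_coalgebra_morphism (pbialg_coalg g) (pbialg_coalg f)).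

Definition pbialg_forget (A B : poissonBialgType k) (f : poissonBialgHom A B) :
  coalgHom A B := CoalgHom (pbialg_coalg f).

End HomTheory.

Record category := Category {
  ob :> Type;
  hom : ob -> ob -> Type;
  idm : forall X, hom X X;
  compm : forall X Y Z, hom Y Z -> hom X Y -> hom X Z;
  comp_idl : forall X Y (f : hom X Y), compm (idm Y) f = f;
  comp_idr : forall X Y (f : hom X Y), compm f (idm X) = f;
  comp_assoc : forall X Y Z T (h : hom Z T) (g : hom Y Z) (f : hom X Y),
    compm h (compm g f) = compm (compm h g) f
}.

Arguments idm {c} X.
Arguments compm {c X Y Z} g f.

Record functor (C D : category) := Functor {
  fob :> C -> D;
  fmap : forall X Y, hom X Y -> hom (fob X) (fob Y);
  fmap_id : forall X, fmap (idm X) = idm (fob X);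
  fmap_comp : forall X Y Z (g : hom Y Z) (f : hom X Y),
    fmap (compm g f) = compm (fmap g) (fmap f)
}.

Arguments fmap {C D} _ {X Y} _.

(* L is left adjoint to F: a bijection hom (L X) A ~ hom X (F A), natural in
   both variables. *)
Definition is_left_adjoint (C D : category) (L : functor D C)
    (F : functor C D) : Prop :=
  exists2 phi : forall (X : D) (A : C), hom (L X) A -> hom X (F A),
    forall X A, bijective (phi X A) &
    forall (X Y : D) (A B : C) (u : hom Y X) (v : hom A B) (f : hom (L X) A),
      phi Y B (compm v (compm f (fmap L u)))
      = compm (fmap F v) (compm (phi X A f) u).

Definition has_left_adjoint (C D : category) (F : functor C D) : Prop :=
  exists L : functor D C, is_left_adjoint L F.

Section Categories.
Variable k : fieldType.

Definition coalgCat : category.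
Proof.
refine (@Category (coalgType k) (@coalgHom k) (@coalg_id k) (@coalg_comp k)
  _ _ _); by move=> *; apply: coalgHom_ext.
Defined.

Definition poissonHopfCat : category.
Proof.
refine (@Category (poissonHopfType k) (fun A B => poissonBialgHom A B)
  (fun A => pbialg_id A) (fun A B C => @pbialg_comp k A B C)
  _ _ _); by move=> *; apply: poissonBialgHom_ext.
Defined.

Definition forgetful : functor poissonHopfCat coalgCat.
Proof.
refine (@Functor poissonHopfCat coalgCat (fun H : poissonHopfType k => H)
  (fun A B => @pbialg_forget k A B) _ _); by move=> *; apply: coalgHom_ext.
Defined.

End Categories.

Definition is_free_poisson_hopf (k : fieldType) (C : coalgType k)
    (G : poissonHopfType k) (i : coalgHom C G) : Prop :=
  forall (H : poissonHopfType k) (f : coalgHom C H),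
    exists! g : poissonBialgHom G H, coalg_comp (pbialg_forget g) i = f.

(* Main.v *)
(* In a commutative Hopf algebra the antipode S is an algebra map with S S = id
   and S[x,y] = - [Sx,Sy], and for a coalgebra map f the map S f is the convolution
   inverse of f.  So the free Poisson Hopf algebra on C is the universal Poisson
   algebra G with a pair of mutually convolution-inverse linear maps i, j : C -> G.
   Its universal property gives the whole structure: the comultiplication comes
   from the pair in G ⊗ G with first member (i ⊗ 1) * (1 ⊗ i) = (i ⊗ i) Δ, and the
   antipode from the pair (j, i) in G with the opposite bracket.  Since convolution
   inverses are unique, Poisson morphisms out of G are determined by their values
   on i(C), where all axioms are immediate.  Only the antipode identity is not an
   equality of Poisson morphisms; its stability under brackets is mulT_tmap_br. *)
Require Import Defs.
From HB Require Import structures.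
From mathcomp Require Import all_boot all_algebra.
From mathcomp Require Import boolp.
From mathcomp Require Import ring.

Set Implicit Arguments.
Unset Strict Implicit.
Unset Printing Implicit Defensive.

Import GRing.Theory.

Local Open Scope ring_scope.
Local Open Scope quotient_scope.

(** * Calculus of Poisson brackets *)

Section Bracket.
Variable k : fieldType.

Section BracketTheory.
Variable P : poissonAlgType k.
Implicit Types x y z : P.

(* Locked, lest rewriting with additivity lemmas unfold the bracket of a tensor
   product into a sum. *)
Definition br x y : P := locked (bracket x y).

Lemma brE x y : br x y = bracket x y.
Proof. by rewrite /br -lock. Qed.

Lemma brDl x y z : br (x + y) z = br x z + br y z.
Proof. rewrite !brE; exact: linearDl. Qed.

Lemma brDr x y z : br z (x + y) = br z x + br z y.
Proof. rewrite !brE; exact: linearDr. Qed.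

Lemma brZl a x y : br (a *: x) y = a *: br x y.
Proof. rewrite !brE; exact: linearZl_LR. Qed.

Lemma brZr a x y : br x (a *: y) = a *: br x y.
Proof. rewrite !brE; exact: linearZr_LR. Qed.

Lemma brxx x : br x x = 0.
Proof. rewrite !brE; exact: bracketxx. Qed.

Lemma brC x y : br x y = - br y x.
Proof. rewrite !brE; exact: bracketC. Qed.

Lemma br_jacobi x y z : br x (br y z) + br y (br z x) + br z (br x y) = 0.
Proof. rewrite !brE; exact: bracket_jacobi. Qed.

Lemma br_leibniz x y z : br x (y * z) = br x y * z + y * br x z.
Proof. rewrite !brE; exact: bracket_leibniz. Qed.

Lemma br_leibnizl x y z : br (x * y) z = br x z * y + x * br y z.
Proof. rewrite !brE; exact: bracket_leibnizl. Qed.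

Lemma br1r x : br x 1 = 0.
Proof.
(* Leibniz on 1 * 1 gives [x, 1] = [x, 1] + [x, 1]. *)
apply: (@addrI _ (br x 1)).
by have := br_leibniz x 1 1; rewrite !mulr1 mul1r addr0 => <-.
Qed.

Lemma br1l x : br 1 x = 0.
Proof. by rewrite brC br1r oppr0. Qed.

End BracketTheory.

Lemma br_pure (P Q : poissonAlgType k) (p r : P) (q s : Q) :
  br (p ⊗ q) (r ⊗ s) = (p * r) ⊗ br q s + br p r ⊗ (q * s).
Proof. rewrite !brE; exact: bracket_pure. Qed.

Lemma br_morphism (P Q : poissonAlgType k) (f : {linear P -> Q}) :
  monoid_morphism f -> {morph f : x y / br x y} -> is_poisson_morphism f.
Proof. by move=> fm fB; split=> // x y; have := fB x y; rewrite !brE. Qed.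

Lemma morph_br (P Q : poissonAlgType k) (f : {linear P -> Q}) :
  is_poisson_morphism f -> {morph f : x y / br x y}.
Proof. by move=> [_ fB] x y; rewrite !brE fB. Qed.

End Bracket.

(** * Morphisms between tensor products *)

Section TensorMorphisms.
Variable k : fieldType.

(** Splits off the factor [tmap f idfun], the shape in which coassociativity and the counit axioms
    are stated. *)
Lemma tmap_compl (U V W X Y : lmodType k) (f : {linear U -> V})
    (g : {linear V -> W}) (h : {linear X -> Y}) (x : U ⊗ X) :
  tmap (g \o f) h x = tmap g h (tmap f idfun x).
Proof.
elim/tensor_ind: x => [u v|x y IHx IHy]; first by rewrite !tmap_pureE.
by rewrite !tmapD IHx IHy.
Qed.

Lemma tmap_compr (U V W X Y : lmodType k) (f : {linear U -> V})
    (g : {linear V -> W}) (h : {linear X -> Y}) (x : X ⊗ U) :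
  tmap h (g \o f) x = tmap h g (tmap idfun f x).
Proof.
elim/tensor_ind: x => [u v|x y IHx IHy]; first by rewrite !tmap_pureE.
by rewrite !tmapD IHx IHy.
Qed.

Lemma tmap_ext (U V W X : lmodType k) (f f' : {linear U -> V})
    (g g' : {linear W -> X}) (x : U ⊗ W) :
  f =1 f' -> g =1 g' -> tmap f g x = tmap f' g' x.
Proof. by move=> /linear_ext -> /linear_ext ->. Qed.

Lemma tassocD (U V W : lmodType k) (x y : (U ⊗ V) ⊗ W) :
  tassoc (x + y) = tassoc x + tassoc y.
Proof. exact: linearD. Qed.

Lemma tassoc_tmap (U V W U' V' W' : lmodType k) (f : {linear U -> U'})
    (g : {linear V -> V'}) (h : {linear W -> W'}) (x : (U ⊗ V) ⊗ W) :
  tassoc (tmap (tmap f g) h x) = tmap f (tmap g h) (tassoc x).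
Proof.
elim/tensor_ind: x => [x w|x y IHx IHy]; last by rewrite !(tassocD, tmapD) IHx IHy.
elim/tensor_ind: x => [u v|x y IHx IHy].
  by rewrite tassoc_pureE !tmap_pureE /= !tmap_pureE tassoc_pureE.
by rewrite pureDl !(pureDl, tassocD, tmapD) IHx IHy.
Qed.

Lemma tmap_monoid_morphism (A A' B B' : comAlgType k) (f : {linear A -> A'})
    (g : {linear B -> B'}) :
  monoid_morphism f -> monoid_morphism g -> monoid_morphism (tmap f g).
Proof.
move=> [f1 fM] [g1 gM]; split=> [|x y].
  by rewrite one_pure tmap_pureE f1 g1.
elim/tensor_ind: x => [a b|x x' IHx IHx']; last first.
  by rewrite mulrDl !tmapD mulrDl IHx IHx'.
elim/tensor_ind: y => [a' b'|y y' IHy IHy']; last first.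
  by rewrite mulrDr !tmapD mulrDr IHy IHy'.
by rewrite mul_pure !tmap_pureE mul_pure fM gM.
Qed.

Lemma tmap_poisson_morphism (A A' B B' : poissonAlgType k)
    (f : {linear A -> A'}) (g : {linear B -> B'}) :
  is_poisson_morphism f -> is_poisson_morphism g ->
  is_poisson_morphism (tmap f g).
Proof.
move=> fP gP; have [[[_ fM] _] [[_ gM] _]] := (fP, gP).
apply: br_morphism => [|x y]; first exact: tmap_monoid_morphism fP.1 gP.1.
change (tmap f g (br x y) = br (tmap f g x) (tmap f g y)).
elim/tensor_ind: x => [a b|x x' IHx IHx']; last first.
  by rewrite brDl !tmapD brDl IHx IHx'.
elim/tensor_ind: y => [a' b'|y y' IHy IHy']; last first.
  by rewrite brDr !tmapD brDr IHy IHy'.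
by rewrite br_pure tmapD !tmap_pureE br_pure fM gM !morph_br.
Qed.

(** Makes the left side of coassociativity a Poisson morphism, so that it can be tested on
    generators. On pure tensors both brackets expand into three terms, one for each factor that
    carries the bracket. *)
Lemma tassoc_poisson_morphism (A B D : poissonAlgType k) :
  @is_poisson_morphism k ((A ⊗ B) ⊗ D)%type (A ⊗ (B ⊗ D))%type
    (@tassoc k A B D).
Proof.
apply: br_morphism; first split=> [|x y] /=.
- by rewrite one_pure [X in X ⊗ _]one_pure tassoc_pureE.
- elim/tensor_ind: x => [x c|x x' IHx IHx']; last first.
    by rewrite mulrDl !tassocD mulrDl IHx IHx'.
  elim/tensor_ind: x => [a b|x x' IHx IHx']; last first.
    by rewrite pureDl mulrDl !tassocD mulrDl IHx IHx'.
  elim/tensor_ind: y => [y c'|y y' IHy IHy']; last first.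
    by rewrite mulrDr !tassocD mulrDr IHy IHy'.
  elim/tensor_ind: y => [a' b'|y y' IHy IHy']; last first.
    by rewrite pureDl mulrDr !tassocD mulrDr IHy IHy'.
  by rewrite !tassoc_pureE !mul_pure tassoc_pureE.
- move=> x y.
  change (tassoc (br x y) = br (tassoc x) (tassoc y)).
  elim/tensor_ind: x => [x c|x x' IHx IHx']; last first.
    by rewrite brDl !tassocD brDl IHx IHx'.
  elim/tensor_ind: x => [a b|x x' IHx IHx']; last first.
    by rewrite pureDl brDl !tassocD brDl IHx IHx'.
  elim/tensor_ind: y => [y c'|y y' IHy IHy']; last first.
    by rewrite brDr !tassocD brDr IHy IHy'.
  elim/tensor_ind: y => [a' b'|y y' IHy IHy']; last first.
    by rewrite pureDl brDr !tassocD brDr IHy IHy'.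
  rewrite !tassoc_pureE !br_pure !mul_pure.
  by rewrite !(pureDl, pureDr, tassocD) !tassoc_pureE addrA.
Qed.

(** [tinl] and [tinr] serve as the coprojections into a tensor product of algebras; with [A] the
    field they are also the right-hand sides of the counit axioms. *)
Definition tinl (V : lmodType k) (A : comAlgType k) : V -> V ⊗ A :=
  fun v => v ⊗ 1.

Definition tinr (V : lmodType k) (A : comAlgType k) : V -> A ⊗ V :=
  fun v => 1 ⊗ v.

Fact tinl_linear (V : lmodType k) (A : comAlgType k) : linear (@tinl V A).
Proof. by move=> a x y; rewrite /tinl purePl. Qed.

Fact tinr_linear (V : lmodType k) (A : comAlgType k) : linear (@tinr V A).
Proof. by move=> a x y; rewrite /tinr purePr. Qed.

HB.instance Definition _ (V : lmodType k) (A : comAlgType k) :=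
  GRing.isLinear.Build k V (tensor V A) *:%R (@tinl V A) (@tinl_linear V A).

HB.instance Definition _ (V : lmodType k) (A : comAlgType k) :=
  GRing.isLinear.Build k V (tensor A V) *:%R (@tinr V A) (@tinr_linear V A).

Lemma tinl_poisson_morphism (P Q : poissonAlgType k) :
  is_poisson_morphism (@tinl P Q).
Proof.
apply: br_morphism => [|x y].
  by split=> // x y; rewrite /= /tinl mul_pure mulr1.
by rewrite /= /tinl br_pure brxx pure0r add0r mulr1.
Qed.

Lemma tinr_poisson_morphism (P Q : poissonAlgType k) :
  is_poisson_morphism (@tinr P Q).
Proof.
apply: br_morphism => [|x y].
  by split=> // x y; rewrite /= /tinr mul_pure mulr1.
by rewrite /= /tinr br_pure brxx pure0l addr0 mulr1.
Qed.

End TensorMorphisms.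

(** * The convolution product *)

Section Convolution.
Variables (k : fieldType) (C : coalgType k).

Section Unit.
Variable A : comAlgType k.

Definition mulT : A ⊗ A -> A := tlift *%R.

HB.instance Definition _ := GRing.Linear.on mulT.

Lemma mulT_pure (a b : A) : mulT (a ⊗ b) = a * b.
Proof. exact: tlift_pure. Qed.

Lemma mulTD (x y : A ⊗ A) : mulT (x + y) = mulT x + mulT y.
Proof. exact: linearD. Qed.

Lemma mulT_monoid_morphism : monoid_morphism mulT.
Proof.
split=> [|x y]; first by rewrite one_pure mulT_pure mulr1.
elim/tensor_ind: x => [a b|x x' IHx IHx']; last first.
  by rewrite mulrDl !mulTD mulrDl IHx IHx'.
elim/tensor_ind: y => [a' b'|y y' IHy IHy']; last first.
  by rewrite mulrDr !mulTD mulrDr IHy IHy'.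
by rewrite mul_pure !mulT_pure mulrACA.
Qed.

Definition algT (a : k^o) : A := (a : k)%:A.

Fact algT_linear : linear algT.
Proof. by move=> a x y; rewrite /algT scalerDl scalerA. Qed.

HB.instance Definition _ := GRing.isLinear.Build k k^o A *:%R algT algT_linear.

Lemma algT_monoid_morphism : monoid_morphism algT.
Proof. by split=> [|x y]; rewrite /algT ?scale1r // -scalerAl mul1r scalerA. Qed.

End Unit.

Section Monoid.
Variable A : comAlgType k.
Implicit Types f g h : {linear C -> A}.

Definition conv f g : {linear C -> A} := @mulT A \o tmap f g \o comul.

Definition conv1 : {linear C -> A} := @algT A \o counit.

Lemma convA f g h : conv f (conv g h) = conv (conv f g) h.
Proof.
apply: linear_ext => c; rewrite /conv /=.
rewrite (tmap_compr comul (@mulT A \o tmap g h)).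
rewrite (tmap_compl comul (@mulT A \o tmap f g)) -comulA.
(* By coassociativity of [C] both sides are now linear in one triple tensor, so pure tensors
   suffice. *)
elim/tensor_ind: (tmap comul idfun (comul c)) => [X z|X Y]; last first.
  by rewrite !(tassocD, tmapD, mulTD) => -> ->.
elim/tensor_ind: X => [x y|X Y]; last first.
  by rewrite pureDl !(pureDl, tassocD, tmapD, mulTD) => -> ->.
by rewrite tassoc_pureE !tmap_pureE /= !tmap_pureE !mulT_pure mulrA.
Qed.

Lemma conv1f f : conv conv1 f = f.
Proof.
apply: linear_ext => c; rewrite /conv /= (tmap_compl counit (@algT A)).
by rewrite comul_counitl tmap_pureE mulT_pure /= /algT scale1r mul1r.
Qed.

Lemma convf1 f : conv f conv1 = f.
Proof.
apply: linear_ext => c; rewrite /conv /= (tmap_compr counit (@algT A)).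
by rewrite comul_counitr tmap_pureE mulT_pure /= /algT scale1r mulr1.
Qed.

Definition conv_inverse f g := conv f g = conv1 /\ conv g f = conv1.

Lemma conv_inverse_uniq f g h :
  conv_inverse f g -> conv_inverse f h -> g = h.
Proof.
by move=> [_ gf] [fh _]; rewrite -[LHS]convf1 -fh convA gf conv1f.
Qed.

Lemma conv_inverse_sym f g : conv_inverse f g -> conv_inverse g f.
Proof. by case. Qed.

(** As [C] need not be cocommutative, convolution need not commute even though [A] does, whence the
    reversed order. *)
Lemma conv_inverse_conv f f' g g' : conv_inverse f f' -> conv_inverse g g' ->
  conv_inverse (conv f g) (conv g' f').
Proof.
move=> [ff' f'f] [gg' g'g]; split.
  by rewrite -convA (convA g) gg' conv1f.
by rewrite -convA (convA f') f'f conv1f.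
Qed.

End Monoid.

Lemma conv1_compE (A B : comAlgType k) (p : {linear A -> B}) (c : C) :
  monoid_morphism p -> p (conv1 A c) = conv1 B c.
Proof. by move=> [p1 _]; rewrite /= /algT linearZ p1. Qed.

Lemma conv_compE (A B : comAlgType k) (p : {linear A -> B})
    (f g : {linear C -> A}) (c : C) : monoid_morphism p ->
  p (conv f g c) = conv (p \o f) (p \o g) c.
Proof.
move=> [_ pM]; rewrite /conv /=.
elim/tensor_ind: (comul c) => [x y|x y].
  by rewrite !tmap_pureE !mulT_pure pM.
by rewrite !(tmapD, mulTD) linearD => -> ->.
Qed.

Lemma conv_inverse_comp (A B : comAlgType k) (p : {linear A -> B})
    (f g : {linear C -> A}) : monoid_morphism p ->
  conv_inverse f g -> conv_inverse (p \o f) (p \o g).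
Proof.
move=> pm [fg gf]; split; apply: linear_ext => c;
  by rewrite -conv_compE // ?fg ?gf conv1_compE.
Qed.

(** On x ⊗ y this is (f x ⊗ 1) (1 ⊗ g y) = f x ⊗ g y. It computes the comultiplication of [free] on
    generators. *)
Lemma conv_tinl_tinr (A : comAlgType k) (f g : {linear C -> A}) :
  conv (@tinl k A A \o f) (@tinr k A A \o g) = tmap f g \o comul.
Proof.
apply: linear_ext => c; rewrite /conv /=.
elim/tensor_ind: (comul c) => [x y|x y]; last by rewrite !(tmapD, mulTD) => -> ->.
by rewrite !tmap_pureE mulT_pure mul_pure mulr1 mul1r.
Qed.

End Convolution.

(** * The bracket identity behind the antipode axioms *)

Section BracketProduct.
Variables (k : fieldType) (P Q : poissonAlgType k) (s t : {linear P -> Q}).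

Definition ad (u x : Q) : Q := br u x.

Fact ad_linear u : linear (ad u).
Proof. by move=> a x y; rewrite /ad brDr brZr. Qed.

HB.instance Definition _ u := GRing.isLinear.Build k Q Q *:%R (ad u) (ad_linear u).

(** This is the part of [u, s x * t y] in which the bracket meets the first factor only. *)
Let lad u (X : P ⊗ P) : Q := mulT (tmap (ad u \o s) t X).

Let lad_pure u x y : lad u (x ⊗ y) = br u (s x) * t y.
Proof. by rewrite /lad tmap_pureE mulT_pure. Qed.

Let ladD u X Y : lad u (X + Y) = lad u X + lad u Y.
Proof. by rewrite /lad tmapD mulTD. Qed.

Let ladDl u v X : lad (u + v) X = lad u X + lad v X.
Proof.
elim/tensor_ind: X => [x y|X Y IHX IHY]; first by rewrite !lad_pure brDl mulrDl.
by rewrite !ladD IHX IHY addrACA.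
Qed.

Let lad_alg (a : k) X : lad a%:A X = 0.
Proof.
elim/tensor_ind: X => [x y|X Y IHX IHY]; last by rewrite ladD IHX IHY addr0.
by rewrite lad_pure brZl br1l scaler0 mul0r.
Qed.

Hypotheses (sM : {morph s : x y / x * y}) (tM : {morph t : x y / x * y}).
(** One sign covers both antipode identities: [e = 1] is for the antipode as [s] and the identity as
    [t], [e = -1] for the two exchanged. *)
Variable e : k.
Hypothesis sB : forall x y, s (br x y) = - (e *: br (s x) (s y)).
Hypothesis tB : forall x y, t (br x y) = e *: br (t x) (t y).

Let m (X : P ⊗ P) : Q := mulT (tmap s t X).

Let mD X Y : m (X + Y) = m X + m Y.
Proof. by rewrite /m tmapD mulTD. Qed.

Let m_pure x y : m (x ⊗ y) = s x * t y.
Proof. by rewrite /m tmap_pureE mulT_pure. Qed.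

(** For X = a ⊗ b and Y = c ⊗ d, Leibniz reduces the first two terms to s c [s a t b, t d], and the
    mixed bracket [s a, t d] in it cancels against [lad (m Y) X]. What is left is s a s c [t b, t d]
    - [s a, s c] t b t d. The point of this form is that every term on the right contains a bracket
    with [m X] or [m Y], so all of it vanishes when these are scalars. *)
Let m_br X Y : m (br X Y) = e *: (br (m X) (m Y) - lad (m X) Y + lad (m Y) X).
Proof.
elim/tensor_ind: X => [a b|X X' IHX IHX']; last first.
  rewrite brDl !mD brDl ladDl ladD IHX IHX' -scalerDr; congr (_ *: _); ring.
elim/tensor_ind: Y => [c d|Y Y' IHY IHY']; last first.
  rewrite brDr !mD brDr ladDl ladD IHY IHY' -scalerDr; congr (_ *: _); ring.
rewrite br_pure mD !m_pure !lad_pure sM tM sB tB mulNr -scalerAl -scalerAr -scalerBr.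
congr (_ *: _); rewrite (brC (s c * t d)) !(br_leibniz, br_leibnizl); ring.
Qed.

(* With X = x1 ⊗ x2, Y = y1 ⊗ y2 (sums implied), s an antipode, t = id and e = 1:
   s(x1) x2 being scalar, 0 = [s(x1) x2, s(y1)] y2, which means
   s(x1) y2 [x2, s(y1)] = - x2 y2 [s(x1), s(y1)]; with its mirror image this turns
   the expansion of [s(x1) x2, s(y1) y2] = 0 into
   s(x1) s(y1) [x2, y2] - [s(x1), s(y1)] x2 y2 = 0. *)
Lemma mulT_tmap_br X Y (a b : k) :
  mulT (tmap s t X) = a%:A -> mulT (tmap s t Y) = b%:A ->
  mulT (tmap s t (br X Y)) = 0.
Proof.
move=> mX mY; have := m_br X Y; rewrite /m mX mY => ->.
by rewrite !lad_alg brZl br1l scaler0 subrr addr0 scaler0.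
Qed.

End BracketProduct.

(** * The opposite Poisson algebra *)

Section OppositeBracket.
Variable k : fieldType.

(** A type alias lets the same commutative algebra carry a second, reversed bracket. *)
Definition oppP (P : Type) : Type := P.

HB.instance Definition _ (P : poissonAlgType k) := GRing.ComAlgebra.on (oppP P).

Variable P : poissonAlgType k.

Definition obracket (x y : oppP P) : oppP P := bracket (y : P) (x : P).

Fact obracket_bilinear : bilinear_for *:%R *:%R obracket.
Proof. by split=> [y a x x' | y a x x']; [exact: linearPr | exact: linearPl]. Qed.

HB.instance Definition _ := bilinear_isBilinear.Build k (oppP P) (oppP P) (oppP P)
  *:%R *:%R obracket obracket_bilinear.

Fact obracketxx x : obracket x x = 0. Proof. exact: bracketxx. Qed.

Fact obracket_jacobi x y z : obracket x (obracket y z)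
  + obracket y (obracket z x) + obracket z (obracket x y) = 0.
Proof.
rewrite /obracket !(@bracketC _ P (bracket _ _)) -!opprD.
by rewrite (bracketC z y) (bracketC x z) (bracketC y x) !linearN -!opprD
  opprK bracket_jacobi.
Qed.

Fact obracket_leibniz p q r :
  obracket p (q * r) = obracket p q * r + q * obracket p r.
Proof. exact: bracket_leibnizl. Qed.

HB.instance Definition _ :=
  isPoisson.Build k (oppP P) obracketxx obracket_jacobi obracket_leibniz.

End OppositeBracket.

(** * Construction of the free Poisson Hopf algebra *)

Section FreePoissonHopf.
Variables (k : fieldType) (C : coalgType k).

(** Models carry no coalgebra structure, so [k^o], [free ⊗ free] and [oppP free] can serve as
    targets of evaluation; the structure maps of [free] arise that way. *)
Record model := Model {
  mod_alg :> poissonAlgType k;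
  mod_i : {linear C -> mod_alg};
  mod_j : {linear C -> mod_alg};
  mod_ij : conv_inverse mod_i mod_j
}.

Inductive term : Type :=
| Ti of C
| Tj of C
| T0
| T1
| TD of term & term
| TZ of k & term
| TM of term & term
| TB of term & term.

Fixpoint eval (m : model) (t : term) : m :=
  match t with
  | Ti c => mod_i m c
  | Tj c => mod_j m c
  | T0 => 0
  | T1 => 1
  | TD t u => eval m t + eval m u
  | TZ a t => a *: eval m t
  | TM t u => eval m t * eval m u
  | TB t u => br (eval m t) (eval m u)
  end.

HB.instance Definition _ := gen_eqMixin term.
HB.instance Definition _ := gen_choiceMixin term.

(* Two terms are identified when they agree in all models: every identity valid
   in Poisson algebras then holds in the quotient for free. *)
Definition term_eqb : rel term :=
  fun t u => `[< forall m, eval m t = eval m u >].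

Fact term_eqb_refl : reflexive term_eqb.
Proof. by move=> t; apply/asboolP. Qed.

Fact term_eqb_sym : symmetric term_eqb.
Proof. by move=> t u; apply/asboolP/asboolP => tu m; rewrite tu. Qed.

Fact term_eqb_trans : transitive term_eqb.
Proof.
by move=> u t v /asboolP tu /asboolP uv; apply/asboolP => m; rewrite tu uv.
Qed.

Canonical term_equiv := EquivRel term_eqb term_eqb_refl term_eqb_sym term_eqb_trans.

(** As the models enter only through a proposition, [free] does not outgrow the universe in which
    models live. *)
Definition free : Type := {eq_quot term_equiv}.
HB.instance Definition _ := Choice.on free.

Implicit Types (t u : term) (x y z : free) (m : model).

Definition fpi t : free := \pi_{eq_quot term_equiv} t.
Definition frep x : term := repr (x : {eq_quot term_equiv}).

Lemma frepK x : fpi (frep x) = x.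
Proof. by rewrite /fpi /frep reprK. Qed.

Definition ev_fun m x : m := eval m (frep x).

Lemma ev_pi m t : ev_fun m (fpi t) = eval m t.
Proof.
have /eqmodP/asboolP : fpi (frep (fpi t)) = fpi t by rewrite frepK.
exact.
Qed.

(** Models separate points, so each equational axiom below is inherited from all models at once. *)
Lemma free_ext x y : (forall m, ev_fun m x = ev_fun m y) -> x = y.
Proof.
move=> xy; rewrite -(frepK x) -(frepK y); apply/eqmodP/asboolP => m; exact: xy.
Qed.

(** * Poisson algebra structure on the quotient *)

Definition fadd x y := fpi (TD (frep x) (frep y)).
Definition fscale a x := fpi (TZ a (frep x)).
Definition fmul x y := fpi (TM (frep x) (frep y)).
Definition fbr x y := fpi (TB (frep x) (frep y)).

Let ev_fadd m x y : ev_fun m (fadd x y) = ev_fun m x + ev_fun m y.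
Proof. exact: ev_pi. Qed.
Let ev_fscale m a x : ev_fun m (fscale a x) = a *: ev_fun m x.
Proof. exact: ev_pi. Qed.
Let ev_fmul m x y : ev_fun m (fmul x y) = ev_fun m x * ev_fun m y.
Proof. exact: ev_pi. Qed.
Let ev_fbr m x y : ev_fun m (fbr x y) = br (ev_fun m x) (ev_fun m y).
Proof. exact: ev_pi. Qed.
Let ev_f0 m : ev_fun m (fpi T0) = 0. Proof. exact: ev_pi. Qed.
Let ev_f1 m : ev_fun m (fpi T1) = 1. Proof. exact: ev_pi. Qed.
Let evE := (ev_fadd, ev_fscale, ev_fmul, ev_fbr, ev_f0, ev_f1).

Fact faddA : associative fadd.
Proof. by move=> x y z; apply: free_ext => m; rewrite !evE addrA. Qed.

Fact faddC : commutative fadd.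
Proof. by move=> x y; apply: free_ext => m; rewrite !evE addrC. Qed.

Fact fadd0 : left_id (fpi T0) fadd.
Proof. by move=> x; apply: free_ext => m; rewrite !evE add0r. Qed.

Fact faddN : left_inverse (fpi T0) (fscale (-1)) fadd.
Proof. by move=> x; apply: free_ext => m; rewrite !evE scaleN1r addNr. Qed.

HB.instance Definition _ := GRing.isZmodule.Build free faddA faddC fadd0 faddN.

Fact fscaleA a b x : fscale a (fscale b x) = fscale (a * b) x.
Proof. by apply: free_ext => m; rewrite !evE scalerA. Qed.

Fact fscale1 : left_id 1 fscale.
Proof. by move=> x; apply: free_ext => m; rewrite !evE scale1r. Qed.

Fact fscaleDr : right_distributive fscale +%R.
Proof. by move=> a x y; apply: free_ext => m; rewrite !evE scalerDr. Qed.

Fact fscaleDl x : {morph fscale^~ x : a b / a + b}.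
Proof. by move=> a b; apply: free_ext => m; rewrite !evE scalerDl. Qed.

HB.instance Definition _ :=
  GRing.Zmodule_isLmodule.Build k free fscaleA fscale1 fscaleDr fscaleDl.

(** Both members are the counit of [C], the unit of convolution and so its own inverse. This model
    shows that [free] is nonzero, and evaluation in it will be the counit of [free]. *)
Definition trivial_model : model :=
  @Model k^o (@conv1 k C k^o) (@conv1 k C k^o) (conj (conv1f _) (conv1f _)).

Fact fmulA : associative fmul.
Proof. by move=> x y z; apply: free_ext => m; rewrite !evE mulrA. Qed.

Fact fmulC : commutative fmul.
Proof. by move=> x y; apply: free_ext => m; rewrite !evE mulrC. Qed.

Fact fmul1 : left_id (fpi T1) fmul.
Proof. by move=> x; apply: free_ext => m; rewrite !evE mul1r. Qed.

Fact fmulDl : left_distributive fmul +%R.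
Proof. by move=> x y z; apply: free_ext => m; rewrite !evE mulrDl. Qed.

Fact fone_neq0 : fpi T1 != 0.
Proof.
apply/eqP => /(congr1 (ev_fun trivial_model)).
by rewrite !evE; apply/eqP/oner_neq0.
Qed.

HB.instance Definition _ := GRing.Zmodule_isComNzRing.Build free
  fmulA fmulC fmul1 fmulDl fone_neq0.

Fact fscalerAl (a : k) (x y : free) : a *: (x * y) = (a *: x) * y.
Proof. by apply: free_ext => m; rewrite !evE scalerAl. Qed.

HB.instance Definition _ := GRing.Lmodule_isLalgebra.Build k free fscalerAl.
HB.instance Definition _ := GRing.Lalgebra_isComAlgebra.Build k free.

Fact fbr_bilinear : bilinear_for *:%R *:%R fbr.
Proof.
split=> [z a x y|z a x y] /=; apply: free_ext => m.
  by rewrite !evE brDl brZl.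
by rewrite !evE brDr brZr.
Qed.

HB.instance Definition _ := bilinear_isBilinear.Build k free free free
  *:%R *:%R fbr fbr_bilinear.

Fact fbrxx x : fbr x x = 0.
Proof. by apply: free_ext => m; rewrite !evE brxx. Qed.

Fact fbr_jacobi x y z : fbr x (fbr y z) + fbr y (fbr z x) + fbr z (fbr x y) = 0.
Proof. by apply: free_ext => m; rewrite !evE br_jacobi. Qed.

Fact fbr_leibniz x y z : fbr x (y * z) = fbr x y * z + y * fbr x z.
Proof. by apply: free_ext => m; rewrite !evE br_leibniz. Qed.

HB.instance Definition _ := isPoisson.Build k free fbrxx fbr_jacobi fbr_leibniz.

Lemma br_free x y : br x y = fbr x y.
Proof. exact: brE. Qed.

(** * Evaluation morphisms and the universal pair *)

Fact ev_linear m : linear (ev_fun m).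
Proof. by move=> a x y; rewrite !evE. Qed.

HB.instance Definition _ m :=
  GRing.isLinear.Build k free m *:%R (ev_fun m) (ev_linear m).

Definition ev m : {linear free -> m} := ev_fun m.

Lemma ev_poisson_morphism m : is_poisson_morphism (ev m).
Proof.
by apply: br_morphism => [|x y]; [split=> [|x y]|rewrite br_free]; rewrite /= evE.
Qed.

Definition fi_fun (c : C) : free := fpi (Ti c).
Definition fj_fun (c : C) : free := fpi (Tj c).

Fact fi_linear : linear fi_fun.
Proof.
by move=> a c d; apply: free_ext => m; rewrite !evE !ev_pi /= linearP.
Qed.

Fact fj_linear : linear fj_fun.
Proof.
by move=> a c d; apply: free_ext => m; rewrite !evE !ev_pi /= linearP.
Qed.

HB.instance Definition _ := GRing.isLinear.Build k C free *:%R fi_fun fi_linear.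
HB.instance Definition _ := GRing.isLinear.Build k C free *:%R fj_fun fj_linear.

Definition fi : {linear C -> free} := fi_fun.
Definition fj : {linear C -> free} := fj_fun.

Lemma ev_fi m c : ev m (fi c) = mod_i m c. Proof. exact: ev_pi. Qed.
Lemma ev_fj m c : ev m (fj c) = mod_j m c. Proof. exact: ev_pi. Qed.

Lemma ev_comp_fi m : (ev m \o fi : {linear C -> m}) = mod_i m.
Proof. by apply: linear_ext => c; exact: ev_fi. Qed.

Lemma ev_comp_fj m : (ev m \o fj : {linear C -> m}) = mod_j m.
Proof. by apply: linear_ext => c; exact: ev_fj. Qed.

(** Evaluation commutes with convolution, and the pair of every model is inverse. Thus [free] with
    [fi] and [fj] is itself a model. *)
Lemma conv_inverse_fi_fj : conv_inverse fi fj.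
Proof.
split; apply: linear_ext => c; apply: free_ext => m; have [mij mji] := mod_ij m.
  change (ev m (conv fi fj c) = ev m (conv1 C free c)).
  rewrite conv_compE ?conv1_compE ?ev_comp_fi ?ev_comp_fj ?mij //;
    exact: (ev_poisson_morphism m).1.
change (ev m (conv fj fi c) = ev m (conv1 C free c)).
rewrite conv_compE ?conv1_compE ?ev_comp_fi ?ev_comp_fj ?mji //;
  exact: (ev_poisson_morphism m).1.
Qed.

(** Every element is the class of a term, so the two copies of [C] generate [free] as a Poisson
    algebra. *)
Lemma free_ind (Q : free -> Prop) :
  (forall c, Q (fi c)) -> (forall c, Q (fj c)) -> Q 1 ->
  (forall a x y, Q x -> Q y -> Q (a *: x + y)) ->
  (forall x y, Q x -> Q y -> Q (x * y)) ->
  (forall x y, Q x -> Q y -> Q (br x y)) ->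
  forall x, Q x.
Proof.
move=> Qi Qj Q1 QL QM QB x; rewrite -(frepK x).
have Q0 : Q 0 by rewrite -(addNr 1) -scaleN1r; apply: QL.
elim: (frep x) => [c|c|||t IHt u IHu|a t IHt|t IHt u IHu|t IHt u IHu].
- exact: Qi.
- exact: Qj.
- exact: Q0.
- exact: Q1.
- by have := QL 1 _ _ IHt IHu; congr Q; apply: free_ext => m;
    rewrite !evE scale1r !ev_pi.
- by have := QL a _ _ IHt Q0; congr Q; apply: free_ext => m;
    rewrite !evE addr0 !ev_pi.
- by have := QM _ _ IHt IHu; congr Q; apply: free_ext => m; rewrite !evE !ev_pi.
- by have := QB _ _ IHt IHu; congr Q; apply: free_ext => m;
    rewrite br_free !evE !ev_pi.
Qed.

(* An algebra morphism is determined on the second copy of C by its values on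
   the first, convolution inverses being unique. *)
Lemma monoid_morphism_fj (A : comAlgType k) (p q : {linear free -> A}) :
  monoid_morphism p -> monoid_morphism q ->
  (forall c, p (fi c) = q (fi c)) -> forall c, p (fj c) = q (fj c).
Proof.
move=> pm qm pq c.
have pij := conv_inverse_comp pm conv_inverse_fi_fj.
have qij := conv_inverse_comp qm conv_inverse_fi_fj.
have pqi : (p \o fi : {linear C -> A}) = q \o fi by exact: linear_ext.
rewrite pqi in pij; have := conv_inverse_uniq pij qij.
by move=> /(congr1 (fun f : {linear C -> A} => f c)).
Qed.

(** It suffices to compare on both copies of [C], and [monoid_morphism_fj] disposes of the second.
    Coassociativity, the counit axioms and the universal property all go through this. *)
Lemma poisson_morphism_free (P : poissonAlgType k) (p q : {linear free -> P}) :
  is_poisson_morphism p -> is_poisson_morphism q ->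
  (forall c, p (fi c) = q (fi c)) -> p =1 q.
Proof.
move=> pP qP pq; apply: free_ind => [//|||a x y IHx IHy|x y IHx IHy|x y IHx IHy].
- exact: monoid_morphism_fj pP.1 qP.1 pq.
- by rewrite pP.1.1 qP.1.1.
- by rewrite !linearP IHx IHy.
- by rewrite pP.1.2 qP.1.2 IHx IHy.
- by rewrite (morph_br pP) (morph_br qP) IHx IHy.
Qed.

(** * Bialgebra structure *)

Definition comul_model : model :=
  @Model (free ⊗ free)%type _ _
    (* The second member is the convolution (1 ⊗ fj) * (fj ⊗ 1): an antipode reverses the
       comultiplication. *)
    (conv_inverse_conv
       (conv_inverse_comp (tinl_poisson_morphism free free).1 conv_inverse_fi_fj)
       (conv_inverse_comp (tinr_poisson_morphism free free).1 conv_inverse_fi_fj)).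

Definition fcomul : {linear free -> (free ⊗ free)%type} := ev comul_model.
Definition fcounit : {linear free -> k^o} := ev trivial_model.

Lemma fcomul_fi c : fcomul (fi c) = tmap fi fi (comul c).
Proof.
apply: etrans (ev_fi comul_model c) _.
exact: (congr1 (fun f : {linear C -> (free ⊗ free)%type} => f c)
  (conv_tinl_tinr fi fi)).
Qed.

Lemma fcounit_fi c : fcounit (fi c) = counit c.
Proof. by rewrite [LHS]ev_fi /= /algT [LHS]mulr1. Qed.

Lemma fcomul_poisson_morphism : is_poisson_morphism fcomul.
Proof. exact: (ev_poisson_morphism comul_model). Qed.

Lemma fcounit_poisson_morphism : is_poisson_morphism fcounit.
Proof. exact: (ev_poisson_morphism trivial_model). Qed.

Fact fcomulA x :
  tassoc (tmap fcomul idfun (fcomul x)) = tmap idfun fcomul (fcomul x).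
Proof.
have idP := id_is_poisson_morphism free.
pose p : {linear free -> (free ⊗ (free ⊗ free))%type} :=
  @tassoc k free free free \o (tmap fcomul idfun \o fcomul).
pose q : {linear free -> (free ⊗ (free ⊗ free))%type} :=
  tmap idfun fcomul \o fcomul.
have pP : is_poisson_morphism p.
  apply: comp_is_poisson_morphism; first exact: tassoc_poisson_morphism.
  apply: comp_is_poisson_morphism; last exact: fcomul_poisson_morphism.
  by apply: tmap_poisson_morphism => //; exact: fcomul_poisson_morphism.
have qP : is_poisson_morphism q.
  apply: comp_is_poisson_morphism; last exact: fcomul_poisson_morphism.
  by apply: tmap_poisson_morphism => //; exact: fcomul_poisson_morphism.
apply: (poisson_morphism_free pP qP) => c.
change (tassoc (tmap fcomul idfun (fcomul (fi c))) =
  tmap idfun fcomul (fcomul (fi c))).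
rewrite fcomul_fi.
(* [fi] respects comultiplications, so both sides are images under [fi] of coassociativity in
   [C]. *)
have -> : tmap fcomul idfun (tmap fi fi (comul c)) =
    tmap (tmap fi fi) fi (tmap comul idfun (comul c)).
  by rewrite -!tmap_comp; apply: tmap_ext => d //; exact: fcomul_fi.
have -> : tmap idfun fcomul (tmap fi fi (comul c)) =
    tmap fi (tmap fi fi) (tmap idfun comul (comul c)).
  by rewrite -!tmap_comp; apply: tmap_ext => d //; exact: fcomul_fi.
by rewrite tassoc_tmap comulA.
Qed.

Fact fcomul_counitl x : tmap fcounit idfun (fcomul x) = (1 : k^o) ⊗ x.
Proof.
pose p : {linear free -> (k^o ⊗ free)%type} := tmap fcounit idfun \o fcomul.
have pP : is_poisson_morphism p.
  apply: comp_is_poisson_morphism; last exact: fcomul_poisson_morphism.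
  by apply: tmap_poisson_morphism => //; exact: fcounit_poisson_morphism.
(* The right-hand side is [tinr] with the field as left factor, a Poisson morphism. *)
apply: (poisson_morphism_free pP (tinr_poisson_morphism free k^o)) => c.
change (tmap fcounit idfun (fcomul (fi c)) = (1 : k^o) ⊗ fi c).
rewrite fcomul_fi.
have -> : tmap fcounit idfun (tmap fi fi (comul c)) =
    tmap idfun fi (tmap counit idfun (comul c)).
  by rewrite -!tmap_comp; apply: tmap_ext => d //; exact: fcounit_fi.
by rewrite comul_counitl tmap_pureE.
Qed.

Fact fcomul_counitr x : tmap idfun fcounit (fcomul x) = x ⊗ (1 : k^o).
Proof.
pose p : {linear free -> (free ⊗ k^o)%type} := tmap idfun fcounit \o fcomul.
have pP : is_poisson_morphism p.
  apply: comp_is_poisson_morphism; last exact: fcomul_poisson_morphism.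
  by apply: tmap_poisson_morphism => //; exact: fcounit_poisson_morphism.
apply: (poisson_morphism_free pP (tinl_poisson_morphism free k^o)) => c.
change (tmap idfun fcounit (fcomul (fi c)) = fi c ⊗ (1 : k^o)).
rewrite fcomul_fi.
have -> : tmap idfun fcounit (tmap fi fi (comul c)) =
    tmap fi idfun (tmap idfun counit (comul c)).
  by rewrite -!tmap_comp; apply: tmap_ext => d //; exact: fcounit_fi.
by rewrite comul_counitr tmap_pureE.
Qed.

HB.instance Definition _ :=
  isCoalgebra.Build k free fcomulA fcomul_counitl fcomul_counitr.

HB.instance Definition _ := isPoissonBialgebra.Build k free
  fcomul_poisson_morphism fcounit_poisson_morphism.

(** * The antipode *)

Definition antipode_model : model :=
  @Model (oppP free) fj fi (conv_inverse_sym conv_inverse_fi_fj).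

Definition fantipode : {linear free -> free} := ev antipode_model.

Lemma fantipode_fi c : fantipode (fi c) = fj c.
Proof. exact: (ev_fi antipode_model). Qed.

Lemma fantipode_monoid_morphism : monoid_morphism fantipode.
Proof. exact: (ev_poisson_morphism antipode_model).1. Qed.

Lemma fantipode_br x y : fantipode (br x y) = - br (fantipode x) (fantipode y).
Proof.
rewrite -brC !brE; exact: (ev_poisson_morphism antipode_model).2.
Qed.

(** The composite m (s ⊗ t) Δ is not known to preserve brackets, so the induction on [free] is done
    by hand instead of through [poisson_morphism_free]. It does preserve products, which settles
    [fj] by uniqueness of convolution inverses. *)
Lemma mulT_fcomul (s t : {linear free -> free}) (e : k) :
  monoid_morphism s -> monoid_morphism t ->
  (forall x y, s (br x y) = - (e *: br (s x) (s y))) ->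
  (forall x y, t (br x y) = e *: br (t x) (t y)) ->
  conv (s \o fi) (t \o fi) = conv1 C free ->
  forall x, mulT (tmap s t (fcomul x)) = (fcounit x : k)%:A.
Proof.
move=> sm tm sB tB st.
pose p : {linear free -> free} := @mulT k free \o (tmap s t \o fcomul).
pose q : {linear free -> free} := @algT k free \o fcounit.
have pm : monoid_morphism p.
  have [[D1 DM] _] := fcomul_poisson_morphism.
  have [T1 TM] := tmap_monoid_morphism sm tm.
  have [M1 MM] := mulT_monoid_morphism free.
  split=> [|x y].
    by change (mulT (tmap s t (fcomul 1)) = 1); rewrite D1 T1 M1.
  change (mulT (tmap s t (fcomul (x * y))) =
    mulT (tmap s t (fcomul x)) * mulT (tmap s t (fcomul y))).
  by rewrite DM TM MM.
have qm : monoid_morphism q.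
  have [[D1 DM] _] := fcounit_poisson_morphism.
  have [A1 AM] := algT_monoid_morphism free.
  split=> [|x y].
    by change (algT free (fcounit 1) = 1); rewrite D1.
  change (algT free (fcounit (x * y)) =
    algT free (fcounit x) * algT free (fcounit y)).
  by rewrite DM AM.
have pqi c : p (fi c) = q (fi c).
  change (mulT (tmap s t (fcomul (fi c))) = algT free (fcounit (fi c))).
  rewrite fcomul_fi fcounit_fi -tmap_comp.
  exact: (congr1 (fun f : {linear C -> free} => f c) st).
change (p =1 q).
apply: free_ind => [//|||a x y IHx IHy|x y IHx IHy|x y IHx IHy].
- exact: monoid_morphism_fj pm qm pqi.
- by rewrite pm.1 qm.1.
- by rewrite !linearP IHx IHy.
- by rewrite pm.2 qm.2 IHx IHy.
(* The induction hypotheses say that both values are scalars, so [mulT_tmap_br] gives 0; on the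
   right the counit lands in the field, whose bracket is zero. *)
- change (mulT (tmap s t (fcomul (br x y))) = algT free (fcounit (br x y))).
  rewrite (morph_br fcomul_poisson_morphism) (morph_br fcounit_poisson_morphism).
  rewrite (mulT_tmap_br sm.2 tm.2 sB tB IHx IHy) brE /algT.
  by rewrite [bracket _ _](_ : _ = 0) // scale0r.
Qed.

Fact fantipodeP : is_antipode fantipode.
Proof.
have Sm := fantipode_monoid_morphism.
have im : monoid_morphism (idfun : {linear free -> free}) by [].
have Si : (fantipode \o fi : {linear C -> free}) = fj.
  by apply: linear_ext => c; exact: fantipode_fi.
have idi : (idfun \o fi : {linear C -> free}) = fi by exact: linear_ext.
have [ij ji] := conv_inverse_fi_fj.
split=> x.
  apply: (mulT_fcomul (e := 1)) => // [y z|y z|].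
  - by rewrite scale1r fantipode_br.
  - by rewrite scale1r.
  - by rewrite Si idi.
apply: (mulT_fcomul (e := -1)) => // [y z|y z|].
- by rewrite scaleN1r opprK.
- by rewrite scaleN1r fantipode_br.
- by rewrite Si idi.
Qed.

HB.instance Definition _ :=
  hasAntipode.Build k free (ex_intro _ fantipode fantipodeP).

(** * The universal property *)

Fact fi_is_coalgebra_morphism : is_coalgebra_morphism fi.
Proof. by split=> c; [exact: fcomul_fi | exact: fcounit_fi]. Qed.

Definition free_unit : coalgHom C free := CoalgHom fi_is_coalgebra_morphism.

Lemma free_unit_universal : is_free_poisson_hopf free_unit.
Proof.
move=> H f; have [S [Sl Sr]] := antipode_ex (s := H).
have [fm fu] := coalg_funP f.
(* As f is a coalgebra map, f * (S ∘ f) = (id * S) ∘ f, and likewise on the other side; the antipode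
   axioms of [H] conclude. *)
have fSf : conv_inverse f (S \o f).
  split; apply: linear_ext => c.
    have := Sr (f c); rewrite fm fu -tmap_comp => SrE.
    by apply: etrans SrE; congr mulT; apply: tmap_ext.
  have := Sl (f c); rewrite fm fu -tmap_comp => SlE.
  by apply: etrans SlE; congr mulT; apply: tmap_ext.
pose m := @Model H f (S \o f) fSf.
pose g : {linear free -> H} := ev m.
have gP : is_poisson_morphism g := ev_poisson_morphism m.
have gi c : g (fi c) = f c by exact: (ev_fi m c).
(* Each identity compares two Poisson morphisms out of [free], and on [fi] it is the one assumed for
   f. *)
have gC : is_coalgebra_morphism g.
  split.
    apply: (@poisson_morphism_free _ (comul \o g) (tmap g g \o fcomul)).
    - exact: comp_is_poisson_morphism comul_poisson gP.
    - apply: comp_is_poisson_morphism fcomul_poisson_morphism.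
      exact: tmap_poisson_morphism.
    - move=> c.
      change (comul (g (fi c)) = tmap g g (fcomul (fi c))).
      by rewrite fcomul_fi gi fm -tmap_comp; apply: tmap_ext => d; rewrite /= gi.
  apply: (@poisson_morphism_free _ (counit \o g) fcounit).
  - exact: comp_is_poisson_morphism counit_poisson gP.
  - exact: fcounit_poisson_morphism.
  - by move=> c; rewrite fcounit_fi -fu -gi.
exists (PoissonBialgHom gP gC); split; first exact: coalgHom_ext.
move=> h hf; apply: poissonBialgHom_ext.
apply: poisson_morphism_free gP (pbialg_poisson h) _ => c.
by rewrite gi -hf.
Qed.

End FreePoissonHopf.

(** * The left adjoint functor *)

Section Adjunction.
Variable k : fieldType.
Implicit Types (C D : coalgType k) (H : poissonHopfType k).

(** The adjunction needs a function, so a lift is chosen; [free_lift_uniq] makes the choice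
    immaterial. *)
Definition free_lift C H (f : coalgHom C H) : poissonBialgHom (free C) H :=
  sval (cid (free_unit_universal f)).

Lemma free_liftK C H (f : coalgHom C H) :
  coalg_comp (pbialg_forget (free_lift f)) (free_unit C) = f.
Proof. by rewrite /free_lift; case: cid => g []. Qed.

Lemma free_lift_uniq C H (g g' : poissonBialgHom (free C) H) :
  coalg_comp (pbialg_forget g) (free_unit C)
    = coalg_comp (pbialg_forget g') (free_unit C) -> g = g'.
Proof.
move=> gg'; have [h [_ hU]] := free_unit_universal
  (coalg_comp (pbialg_forget g') (free_unit C)).
by rewrite -(hU g gg') (hU g').
Qed.

Definition free_map C D (u : coalgHom C D) : poissonBialgHom (free C) (free D) :=
  free_lift (coalg_comp (free_unit D) u).

Definition free_functor : functor (coalgCat k) (poissonHopfCat k).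
Proof.
refine (@Functor (coalgCat k) (poissonHopfCat k)
  (fun C : coalgType k => (free C : poissonHopfType k)) free_map _ _).
  move=> C; apply: free_lift_uniq; rewrite free_liftK.
  exact: coalgHom_ext.
move=> C D E v u; apply: free_lift_uniq; rewrite free_liftK.
apply: coalgHom_ext => c /=.
have /(congr1 (fun h : coalgHom _ _ => h c)) /= -> :=
  free_liftK (coalg_comp (free_unit D) u).
by have /(congr1 (fun h : coalgHom _ _ => h (u c))) /= -> :=
  free_liftK (coalg_comp (free_unit E) v).
Defined.

Lemma free_functor_left_adjoint : is_left_adjoint free_functor (forgetful k).
Proof.
exists (fun (C : coalgCat k) (H : poissonHopfCat k)
  (g : poissonBialgHom (free C) H) => coalg_comp (pbialg_forget g) (free_unit C)).
  move=> C H; exists (@free_lift C H) => [g|f]; last exact: free_liftK.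
  by apply: free_lift_uniq; exact: free_liftK.
(* Naturality in the Hopf algebra is associativity of composition; naturality in the coalgebra is
   the unit square that defines [free_map u]. *)
move=> C D H K u v f; apply: coalgHom_ext => d /=.
by have /(congr1 (fun h : coalgHom _ _ => h d)) /= -> :=
  free_liftK (coalg_comp (free_unit C) u).
Qed.

End Adjunction.

Theorem theorem3p3 (k : fieldType) :
  has_left_adjoint (forgetful k) /\
  forall C : coalgType k,
    exists (G : poissonHopfType k) (i : coalgHom C G), is_free_poisson_hopf i.
Proof.
split; first by exists (free_functor k); exact: free_functor_left_adjoint.
by move=> C; exists (free C), (free_unit C); exact: free_unit_universal.
Qed.
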